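(* Let $p$ be an odd prime, $m,s$ positive integers, $R=\mathbb F_{p^m}+u\mathbb F_{p^m}$ with $u^2=0$, let $\sigma$ be a ring automorphism of $R$, and let $\gamma\in\mathbb F_{p^m}^\ast$. Let $C$ be a $\gamma$-constacyclic code of length $p^s$ over $R$ with $C=\langle0\rangle$ or $C=\langle1\rangle$. Then $C$ is $\sigma$-self-orthogonal if and only if $C=\langle0\rangle$.
   Context: A $\gamma$-constacyclic code of length $n$ over $R$ is an $R$-submodule of $R^n$ stable under $(x_0,\dots,x_{n-1})\mapsto(\gamma x_{n-1},x_0,\dots,x_{n-2})$; it is identified with an ideal of $R[x]/\langle x^n-\gamma\rangle$ via $(c_0,\dots,c_{n-1})\mapsto c_0+c_1x+\cdots+c_{n-1}x^{n-1}$. The $\sigma$-dual of $C\subseteq R^n$ is $C^{\perp_\sigma}=\{\mathbf x\in R^n:\sum_{i=0}^{n-1}c_i\sigma(x_i)=0\text{ for all }\mathbf c\in C\}$; $C$ is $\sigma$-self-orthogonal if $C\subseteq C^{\perp_\sigma}$. *)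

(* Defs.v *)
From HB Require Import structures.
From mathcomp Require Export all_boot all_algebra all_field.

Set Implicit Arguments.
Unset Strict Implicit.
Unset Printing Implicit Defensive.

Import GRing.Theory.
Local Open Scope ring_scope.

(* F + uF with u^2 = 0, as F[u]/<u^2>, where u is 'qX *)
Definition dual_numbers (F : finFieldType) : predArgType :=
  {poly %/ ('X^2 : {poly F})}.

HB.instance Definition _ (F : finFieldType) :=
  FinRing.ComUnitRing.on (dual_numbers F).
HB.instance Definition _ (F : finFieldType) :=
  GRing.ComUnitAlgebra.on (dual_numbers F).

Definition dual_const (F : finFieldType) (a : F) : dual_numbers F := a%:A.

(* For n > 0 the polynomial 'X^n - g%:P is monic of positive degree, so
   this is R[x]/<x^n - g>; for n = 0 the library quotients by 'X instead. *)
Definition code_ring (R : finComNzRingType) (n : nat) (g : R) : predArgType :=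
  {poly %/ ('X^n - g%:P)}.

HB.instance Definition _ (R : finComNzRingType) n (g : R) :=
  GRing.ComNzRing.on (code_ring n g).
HB.instance Definition _ (R : finComNzRingType) n (g : R) :=
  Finite.on (code_ring n g).

Section Codes.
Variables (R : finComNzRingType) (n : nat).
Implicit Types (g : R) (x : 'rV[R]_n) (C : {set 'rV[R]_n}).

(* (x_0, ..., x_(n-1)) |-> (g x_(n-1), x_0, ..., x_(n-2));
   ord_pred is the cyclic predecessor. *)
Definition constashift g x : 'rV[R]_n :=
  \row_i (if i == 0%N :> nat then g * x 0 (ord_pred i) else x 0 (ord_pred i)).

Definition constacyclic_code g C : Prop :=
  submod_closed C /\ {in C, forall x, constashift g x \in C}.

(* x |-> x_0 + x_1 X + ... + x_(n-1) X^(n-1) modulo X^n - g *)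
Definition code_poly g x : code_ring n g := in_qpoly ('X^n - g%:P) (rVpoly x).

Definition code_ideal g C : {set code_ring n g} := code_poly g @: C.

Definition principal_ideal g (a : code_ring n g) : {set code_ring n g} :=
  [set b * a | b : code_ring n g].

Definition sigma_dual (sigma : R -> R) C : {set 'rV[R]_n} :=
  [set x : 'rV[R]_n |
    [forall c in C, \sum_(i < n) (c : 'rV[R]_n) 0 i * sigma (x 0 i) == 0]].

Definition sigma_self_orthogonal (sigma : R -> R) C : Prop :=
  C \subset sigma_dual sigma C.

End Codes.

(* Main.v *)
Require Import Defs.

Set Implicit Arguments.
Unset Strict Implicit.
Unset Printing Implicit Defensive.

Import GRing.Theory.
Local Open Scope ring_scope.

(** The zero code pairs to zero with everything. If the ideal is the whole ring, then C contains the
    word (1, 0, ..., 0), whose pairing with itself is 1 * sigma(1) = 1, which is nonzero. Both cases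
    must pass from the ideal back to words; [code_poly_inj] allows this, since a polynomial of
    degree below n is its own remainder modulo X^n - g. *)

Lemma code_poly_inj (R : finComNzRingType) (n : nat) (g : R) :
  (0 < n)%N -> injective (@code_poly R n g).
Proof.
move=> n_gt0.
have monP : 'X^n - g%:P \is monic by rewrite monicXnsubC.
have szP : size ('X^n - g%:P) = n.+1 by rewrite size_XnsubC.
(* [mk_monic] falls back to ['X] unless its argument is monic of size above 1; positivity of n
   excludes this default. *)
have mkP : mk_monic ('X^n - g%:P) = 'X^n - g%:P.
  by rewrite /mk_monic szP monP ltnS n_gt0.
have codeE (x : 'rV_n) : code_poly g x = rVpoly x :> {poly R}.
  by rewrite /code_poly in_qpoly_small // mkP szP ltnS size_poly.
move=> x y eq_xy; apply: (can_inj (@rVpolyK _ _)).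
by rewrite -!codeE eq_xy.
Qed.

Lemma trivial_code_self_orthogonal (R : finComNzRingType) (n : nat) (g : R)
    (sigma : {rmorphism R -> R}) (C : {set 'rV[R]_n}) :
  (0 < n)%N ->
  code_ideal g C = principal_ideal 0 \/ code_ideal g C = principal_ideal 1 ->
  sigma_self_orthogonal sigma C <-> code_ideal g C = principal_ideal 0.
Proof.
move=> n_gt0 C01; have code_inj := code_poly_inj (g := g) n_gt0.
split=> [C_orth|C0]; last first.
  apply/subsetP=> x _; rewrite inE; apply/forall_inP=> c Cc.
  (* The zero ideal forces each codeword c to be 0, so every pairing with c vanishes. *)
  have : code_poly g c \in principal_ideal 0 by rewrite -C0 imset_f.
  case/imsetP=> b _; rewrite mulr0 => code_c.
  have -> : c = 0 by apply: code_inj; rewrite code_c /code_poly !linear0.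
  by rewrite big1 // => i _; rewrite mxE mul0r.
case: C01 => // C1.
(* [e] is the word of the constant polynomial 1. Its image lies in the unit ideal, so some codeword
   has the same image, and injectivity identifies that codeword with [e]. *)
pose i0 := Ordinal n_gt0; pose e : 'rV[R]_n := delta_mx 0 i0.
have Ce : e \in C.
  have : code_poly g e \in code_ideal g C.
    by rewrite C1; apply/imsetP; exists (code_poly g e); rewrite ?mulr1.
  by case/imsetP=> c Cc /code_inj->.
have := subsetP C_orth _ Ce; rewrite inE => /forall_inP/(_ e Ce).
(* Only coordinate [i0] contributes to the pairing of [e] with itself, and 1 != 0 in R gives the
   contradiction. *)
rewrite (bigD1 i0) //= big1 => [|i /negbTE ne_i].
  by rewrite !mxE !eqxx mul1r rmorph1 addr0 oner_eq0.
by rewrite !mxE ne_i andbF mul0r.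
Qed.

Theorem theorem4p3 (p m s : nat) (p_prime : prime p) (p_odd : odd p)
    (m_gt0 : (0 < m)%N) (s_gt0 : (0 < s)%N)
    (F : finFieldType) (cardF : #|F| = (p ^ m)%N)
    (sigma : {rmorphism dual_numbers F -> dual_numbers F})
    (sigma_bij : bijective sigma)
    (gamma : F) (gamma_neq0 : gamma != 0)
    (C : {set 'rV[dual_numbers F]_(p ^ s)})
    (C_constacyclic : constacyclic_code (dual_const gamma) C)
    (C_trivial : code_ideal (dual_const gamma) C = principal_ideal 0
              \/ code_ideal (dual_const gamma) C = principal_ideal 1) :
  sigma_self_orthogonal sigma C <->
  code_ideal (dual_const gamma) C = principal_ideal 0.
Proof.
by apply: trivial_code_self_orthogonal C_trivial; rewrite expn_gt0 prime_gt0.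
Qed.
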